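(* Let $n\ge1$, $R>0$, let $B_R\subset\mathbb R^{n+1}$ be an open ball of radius $R$, and let $\delta(x)$ be the distance from $x\in B_R$ to $\partial B_R$. Then for every $f\in C_0^\infty(B_R)$, $$\int_{B_R}|\nabla f|^2\,dx\ \ge\ \frac14\int_{B_R}\frac{|f|^2}{\delta^2}\,dx+\frac{2n}{R^2}\int_{B_R}|f|^2\,dx .$$
   Context: $C_0^\infty(B_R)$ denotes smooth functions with compact support in $B_R$. *)

(* Defs.v *)
From HB Require Import structures.
From mathcomp Require Import all_boot all_order all_algebra.
From mathcomp Require Import all_classical all_reals all_analysis.

Set Implicit Arguments.
Unset Strict Implicit.
Unset Printing Implicit Defensive.

Import Order.TTheory GRing.Theory Num.Theory.
Import numFieldNormedType.Exports.

Local Open Scope classical_set_scope.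
Local Open Scope ring_scope.

Definition measure_rV_display : measure_display -> measure_display.
Proof. exact. Qed.

(* The product sigma-algebra on row vectors, generated by the coordinates, as
   the library does for tuples; for T = R it is the Borel sigma-algebra of
   R^n. *)
Section measurable_rV.
Context {d} {T : measurableType d} (n : nat).

Let coord (i : 'I_n) (x : 'rV[T]_n) : T := x ord0 i.

Let rV_set0 : g_sigma_preimage coord set0.
Proof. exact: sigma_algebra0. Qed.

Let rV_setC A : g_sigma_preimage coord A -> g_sigma_preimage coord (~` A).
Proof. exact: sigma_algebraC. Qed.

Let rV_bigcup (F : _^nat) : (forall i, g_sigma_preimage coord (F i)) ->
  g_sigma_preimage coord (\bigcup_i (F i)).
Proof. exact: sigma_algebra_bigcup. Qed.

HB.instance Definition _ := @isMeasurable.Build (measure_rV_display d)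
  'rV[T]_n (g_sigma_preimage coord) rV_set0 rV_setC rV_bigcup.

End measurable_rV.

Lemma measurable_coord d (T : measurableType d) n (i : 'I_n) :
  measurable_fun setT (fun x : 'rV[T]_n => x ord0 i).
Proof.
move=> _ Y mY; rewrite setTI; apply: sub_sigma_algebra => /=.
rewrite -bigcup_seq/=; exists i => /=; first by rewrite mem_index_enum.
by exists Y => //; rewrite setTI.
Qed.

Lemma measurable_fun_rVP d d' (S : measurableType d) (T : measurableType d') n
    (f : S -> 'rV[T]_n) :
  (forall i, measurable_fun setT (fun s => f s ord0 i)) -> measurable_fun setT f.
Proof.
move=> mf.
suff H : g_sigma_preimage (fun i s => f s ord0 i) `<=` measurable.
  move=> _ A mA; apply: H.
  rewrite (g_sigma_preimage_comp (fun i (x : 'rV[T]_n) => x ord0 i) f).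
  by exists A.
apply: smallest_sub; first exact: sigma_algebra_measurable.
rewrite -bigcup_seq => A [i _ [B mB <-]]; exact: mf.
Qed.

Section lebesgue_rV.
Context {R : realType}.

Definition consrV n (p : measurableTypeR R * 'rV[R]_n) : 'rV[R]_n.+1 :=
  row_mx (const_mx p.1 : 'rV[R]_1) p.2.

Lemma consrV0 n p : @consrV n p ord0 ord0 = p.1.
Proof. by rewrite mxE; case: splitP => // j _; rewrite mxE. Qed.

Lemma consrVS n p i : @consrV n p ord0 (lift ord0 i) = p.2 ord0 i.
Proof.
rewrite mxE; case: splitP => [[[]//]|k /=] ; rewrite /bump/= !add1n => -[] ik.
by congr (_ _ _); apply: val_inj.
Qed.

Lemma measurable_consrV n : measurable_fun setT (@consrV n).
Proof.
apply: measurable_fun_rVP => i; case: (unliftP ord0 i) => [j|] ->.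
- under eq_fun do rewrite consrVS.
  apply: (@measurableT_comp _ _ _ _ _ _ (fun x : 'rV[R]_n => x ord0 j)) => //.
  exact: measurable_coord.
- under eq_fun do rewrite consrV0.
  exact: measurable_fst.
Qed.

Section cons_measure.
Context n (m : {measure set 'rV[R]_n -> \bar R}).

Definition cons_measure : set 'rV[R]_n.+1 -> \bar R :=
  pushforward (lebesgue_measure \x^ m)%E (@consrV n).

Let cons_measure0 : cons_measure set0 = 0%E.
Proof. by rewrite /cons_measure /pushforward preimage_set0 measure0. Qed.

Let cons_measure_ge0 A : (0 <= cons_measure A)%E.
Proof. by rewrite /cons_measure /pushforward. Qed.

Let cons_measure_sigma_additive : semi_sigma_additive cons_measure.
Proof.
move=> F mF tF mUF; rewrite /cons_measure /pushforward preimage_bigcup.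
have mc A : measurable A -> measurable (@consrV n @^-1` A).
  by move=> mA; rewrite -[X in measurable X]setTI; exact: measurable_consrV.
apply: measure_semi_sigma_additive.
- by move=> k; exact: mc.
- apply/trivIsetP => /= i j _ _ ij; rewrite -preimage_setI.
  by move/trivIsetP : tF => /(_ _ _ _ _ ij) ->//; rewrite preimage_set0.
- by rewrite -preimage_bigcup; exact: mc.
Qed.

HB.instance Definition _ := isMeasure.Build _ _ _ cons_measure
  cons_measure0 cons_measure_ge0 cons_measure_sigma_additive.

End cons_measure.

(* Lebesgue measure on R^n as an iterated product; R^0 is one point of mass 1. *)
Fixpoint lebesgue_rV n : {measure set 'rV[R]_n -> \bar R} :=
  if n is n'.+1 then cons_measure (lebesgue_rV n') else \d_(0 : 'rV[R]_0).

Lemma measurable_box n (A : 'I_n -> set (measurableTypeR R)) :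
  (forall i, measurable (A i)) ->
  measurable [set x : 'rV[R]_n | forall i, A i (x ord0 i)].
Proof.
move=> mA.
rewrite (_ : [set x : 'rV[R]_n | _] =
    \bigcap_i ((fun x : 'rV[R]_n => x ord0 i) @^-1` A i)).
  apply: fin_bigcap_measurable; first exact: finite_finset.
  move=> i _; rewrite -[X in measurable X]setTI; apply: measurable_coord => //.
  exact: mA.
by apply/seteqP; split => x /= h i; [move=> _|]; exact: h.
Qed.

Lemma lebesgue_rV_box n (A : 'I_n -> set (measurableTypeR R)) :
  (forall i, measurable (A i)) ->
  lebesgue_rV n [set x | forall i, A i (x ord0 i)] =
  (\prod_(i < n) lebesgue_measure (A i))%E.
Proof.
elim: n A => [|n IH] A mA.
  by rewrite big_ord0 /= diracE mem_set//= => -[].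
rewrite big_ord_recl -IH// -product_measure2E//=; last first.
  by apply: (measurable_box (A := fun i => A (lift ord0 i))) => i; exact: mA.
rewrite /cons_measure /pushforward; congr (product_measure2 _ _ _).
apply/seteqP; split => -[a v] /=.
- move=> h; split => [|i]; first by have := h ord0; rewrite consrV0.
  by have := h (lift ord0 i); rewrite consrVS.
- move=> [ha hv] i.
  by case: (unliftP ord0 i) => [j ->|->]; rewrite ?consrVS ?consrV0//; exact: hv.
Qed.

End lebesgue_rV.

Section euclidean.
Context {R : realType} {n : nat}.
Implicit Types (x c : 'rV[R]_n) (A : set 'rV[R]_n) (f : 'rV[R]_n -> R).

(* The library norm on 'rV[R]_n is the max norm; it induces the same topology
   as [enorm], so closure, interior, compactness and continuity below are the
   usual ones. *)
Definition enorm x : R := Num.sqrt (\sum_(i < n) x ord0 i ^+ 2).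

Definition eball c (r : R) : set 'rV[R]_n := [set x | enorm (x - c) < r].

Definition boundary A : set 'rV[R]_n := closure A `\` interior A.

Definition bdry_dist A x : R := inf [set enorm (x - y) | y in boundary A].

Definition partial (i : 'I_n) f : 'rV[R]_n -> R :=
  fun x => 'D_(delta_mx ord0 i) f x.

Definition grad f x : 'rV[R]_n := \row_i partial i f x.

(* [foldr partial f s] is the iterated partial derivative along the list of
   directions [s]. *)
Definition smooth f : Prop :=
  forall s : seq 'I_n,
    continuous (foldr partial f s) /\
    forall i x, derivable (foldr partial f s) x (delta_mx ord0 i).

Definition fsupport f : set 'rV[R]_n := closure [set x | f x != 0].

(* C_0^oo(A), its members being extended by zero outside A. *)
Definition test_function A f : Prop :=
  [/\ smooth f, compact (fsupport f) & fsupport f `<=` A].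

End euclidean.

(* Main.v *)
Require Import Defs.
From HB Require Import structures.
From mathcomp Require Import all_boot all_order all_algebra.
From mathcomp Require Import all_classical all_reals all_analysis.
From mathcomp Require Import measurable_realfun ring lra.

(** Write q = r^2 - |x - c|^2 and consider the vector field V = G (x - c) with
    G = 1/q + (2/5)/r^2 + (16/25) q/r^4.  Completing the square gives
    |grad f|^2 + div (f^2 V) >= (div V - |V|^2) f^2, and the divergence of the
    compactly supported field f^2 V integrates to zero.  What remains is the
    one-variable inequality
    div V - |V|^2 >= 1/(4 (r - |x - c|)^2) + 2n/r^2 in dimension n + 1. *)

Set Implicit Arguments.
Unset Strict Implicit.
Unset Printing Implicit Defensive.

Import Order.TTheory GRing.Theory Num.Theory.
Import numFieldNormedType.Exports.

Local Open Scope classical_set_scope.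
Local Open Scope ring_scope.

(** * Cubes and sigma-finiteness of Lebesgue measure on row vectors *)

Definition cube (R : realType) n (M : R) : set 'rV[R]_n :=
  [set x | forall i, `[- M, M]%classic (x ord0 i)].

Arguments cube {R} n M _.

Lemma measurable_cube (R : realType) n (M : R) : measurable (cube n M).
Proof. by apply: (measurable_box (A := fun=> `[- M, M]%classic)) => i. Qed.

Arguments measurable_cube {R} n M.

Lemma lebesgue_rV_cube (R : realType) n (M : R) : (lebesgue_rV n (cube n M) < +oo)%E.
Proof.
rewrite (lebesgue_rV_box (A := fun=> `[- M, M]%classic))//.
rewrite ltey_eq; apply/orP; left.
apply: prode_fin_num => i _; rewrite lebesgue_measure_itv /=.
by case: ifP => // _; rewrite -EFinB.
Qed.

Lemma compact_cube (R : realType) n (M : R) : compact (cube n M).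
Proof.
apply: (@rV_compact R n (fun=> `[- M, M]%classic)) => _.
exact: segment_compact.
Qed.

Lemma bigcup_cube (R : realType) n : \bigcup_k cube n (k%:R : R) = setT.
Proof.
apply/seteqP; split => // x _.
(* An integer above the sum of the absolute values of the coordinates bounds each of them. *)
exists (Num.truncn (\sum_i `|x ord0 i|)).+1 => // i /=.
rewrite in_itv /= -ler_norml; apply: le_trans (ltW (truncnS_gt _)).
rewrite (bigD1 i)//= lerDl; exact: sumr_ge0.
Qed.

Lemma sigma_finite_lebesgue_rV (R : realType) n :
  sigma_finite setT (lebesgue_rV n : set 'rV[R]_n -> \bar R).
Proof.
exists (fun k => cube n k%:R); first by rewrite bigcup_cube.
by move=> k; split; [exact: measurable_cube|exact: lebesgue_rV_cube].
Qed.

(** * Measurability and integrability of continuous functions *)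

(** An open set is the union of the boxes with rational centre and radius 1/(k+1) that it contains.
    There are countably many, each in the sigma-algebra generated by the coordinates. *)
Lemma open_measurable_rV (R : realType) n (U : set 'rV[R]_n) : open U -> measurable U.
Proof.
move=> oU.
pose box (q : 'rV[rat]_n * nat) : set 'rV[R]_n :=
  [set x | forall i, ball (ratr (q.1 ord0 i) : R) q.2.+1%:R^-1 (x ord0 i)].
pose F (q : 'rV[rat]_n * nat) : set 'rV[R]_n :=
  [set x | box q `<=` U /\ box q x].
have -> : U = \bigcup_q F q.
  apply/seteqP; split => [x Ux|x [q _ [qU qx]]]; last exact: qU.
  have /nbhs_ballP[e /= e0 eU] : nbhs x U by exact: open_nbhs_nbhs.
  (* Half of [e] suffices: [x] and any point of the box are both within 1/(k+1) of the rational
     centre in each coordinate. *)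
  have [k ke] : exists k : nat, k.+1%:R^-1 < e / 2.
    exists (Num.truncn (e / 2)^-1).
    rewrite invf_plt ?posrE ?divr_gt0 ?ltr0n//.
    exact: truncnS_gt.
  have k0 : 0 < k.+1%:R^-1 :> R by rewrite invr_gt0 ltr0n.
  have hq i : exists q : rat, ball (ratr q : R) k.+1%:R^-1 (x ord0 i).
    have /rat_in_itvoo[q] : x ord0 i - k.+1%:R^-1 < x ord0 i + k.+1%:R^-1.
      by rewrite ltrBlDr -addrA ltrDl addr_gt0.
    rewrite in_itv /= => /andP[q1 q2]; exists q.
    rewrite /ball /= ltr_norml; move: k.+1%:R^-1 q1 q2 => d q1 q2.
    apply/andP; split; lra.
  have /choice[q qP] := hq.
  exists (\row_i q i, k) => //; split => [y hy|i /=]; last by rewrite mxE.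
  apply: eU; split => // i j; rewrite ord1.
  have := hy j; have := qP j; rewrite /= mxE /ball /= => h1 h2.
  move: h1 h2 ke; rewrite !ltr_norml; move: k.+1%:R^-1 => d => /andP[? ?] /andP[? ?] ?.
  by apply/andP; split; lra.
apply: countable_bigcupT_measurable; first exact: countableP.
move=> q; have [qU|qU] := pselect (box q `<=` U).
  rewrite (_ : F q = box q); last by apply/seteqP; split => [x []|x].
  apply: (measurable_box
    (A := fun i => ball (ratr (q.1 ord0 i) : R) q.2.+1%:R^-1)) => i.
  exact: measurable_ball.
rewrite (_ : F q = set0); first exact: measurable0.
by apply/seteqP; split => x // [].
Qed.

Arguments open_measurable_rV {R n} U.

Lemma continuous_measurable_rV (R : realType) n (f : 'rV[R]_n -> R) :
  continuous f -> measurable_fun setT f.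
Proof.
move=> /continuousP cf.
apply: (measurability _ (RGenOpens.measurableE R)) => _ [_ [a [b ->] <-]].
rewrite setTI; apply: open_measurable_rV; apply: cf.
exact: interval_open.
Qed.

Lemma continuous_cube_bounded (R : realType) n (M : R) (f : 'rV[R]_n -> R) :
  continuous f -> exists2 C : R, 0 <= C & forall x, cube n M x -> `|f x| <= C.
Proof.
move=> cf; have /compact_bounded[C [Cr hC]] : compact (f @` cube n M).
  apply: continuous_compact (@compact_cube R n M).
  exact: continuous_subspaceT.
exists (`|C| + 1); first by rewrite addr_ge0.
move=> x Mx; apply: (hC (`|C| + 1)); last by exists x.
by rewrite (le_lt_trans (ler_norm _))// ltrDl.
Qed.

(** [f] is dominated by a constant times the indicator of the cube, which has finite measure. *)
Lemma continuous_integrable_rV (R : realType) n (M : R) (f : 'rV[R]_n -> R) :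
  continuous f -> [set x | f x != 0] `<=` cube n M ->
  (lebesgue_rV n).-integrable setT (EFin \o f).
Proof.
move=> cf fM; have [C C0 hC] := continuous_cube_bounded M cf.
have mf := continuous_measurable_rV cf.
have mM : measurable_fun [set: 'rV[R]_n] (\1_(cube n M) : 'rV[R]_n -> R).
  exact: measurable_indic (measurable_cube n M).
apply/integrableP; split; first exact/measurable_EFinP.
apply: (@le_lt_trans _ _
  (\int[lebesgue_rV n]_x (C%:E * (\1_(cube n M) x)%:E))%E).
  apply: ge0_le_integral => //.
  - by apply: measurableT_comp => //; exact/measurable_EFinP.
  - apply: emeasurable_funM => //; exact/measurable_EFinP.
  move=> x _ /=; rewrite -EFinM lee_fin indicE.
  have [xM|xM] := boolP (x \in cube n M).
    by rewrite mulr1; apply: hC; exact: set_mem.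
  rewrite mulr0; have -> : f x = 0; last by rewrite normr0.
  by apply: contraNeq xM => fx; apply/mem_set/fM.
rewrite ge0_integralZl//; last first.
  exact/measurable_EFinP.
rewrite integral_indic//; last exact: (measurable_cube n M).
rewrite setIT; apply: lte_mul_pinfty => //; exact: lebesgue_rV_cube.
Qed.

(** * Fubini for the recursively defined Lebesgue measure *)

(** The same function [mu], bundled with its sigma-finiteness as the Fubini lemmas require. *)
Definition sigma_finite_pack d (T : measurableType d) (R : realType)
    (mu : {measure set T -> \bar R}) (h : sigma_finite setT mu) :
    {sigma_finite_measure set T -> \bar R} :=
  SigmaFiniteMeasure.Pack (SigmaFiniteMeasure.Class
    (Measure.measure_function_Content_isMeasure_mixin (Measure.class mu))
    (@isSFinite.Build _ _ _ mu (sfinite_measure_sigma_finite h))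
    (@isSigmaFinite.Build _ _ _ mu h)).

Lemma continuous_consrVl (R : realType) n (a : R) :
  continuous (fun v : 'rV[R]_n => consrV (a, v)).
Proof.
move=> v U /nbhs_ballP[e /= e0 eU].
apply/nbhs_ballP; exists e => // w [_ vw]; apply: eU; split => // i j.
rewrite ord1; case: (unliftP ord0 j) => [k|] ->; first by rewrite !consrVS.
by rewrite !consrV0; exact: ballxx.
Qed.

Lemma continuous_consrVr (R : realType) n (v : 'rV[R]_n) :
  continuous (fun a : R => consrV (a, v)).
Proof.
move=> a U /nbhs_ballP[e /= e0 eU].
apply/nbhs_ballP; exists e => // b ab; apply: eU; split => // i j.
rewrite ord1; case: (unliftP ord0 j) => [k|] ->; last by rewrite !consrV0.
by rewrite !consrVS; exact: ballxx.
Qed.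

Section lebesgue_rVS.
Context {R : realType} {n : nat}.
Variables (M : R) (F : 'rV[R]_n.+1 -> R).
Hypotheses (cF : continuous F) (FM : [set x | F x != 0] `<=` cube n.+1 M).

Let m2 : {sigma_finite_measure set 'rV[R]_n -> \bar R} :=
  sigma_finite_pack (@sigma_finite_lebesgue_rV R n).

Let G (p : measurableTypeR R * 'rV[R]_n) : \bar R := (F (consrV p))%:E.

Let mF : measurable_fun setT (EFin \o F).
Proof. by apply/measurable_EFinP; exact: continuous_measurable_rV. Qed.

Let mG : measurable_fun setT G.
Proof. exact: (measurableT_comp mF (@measurable_consrV R n)). Qed.

Let iG2 : (lebesgue_measure \x^ m2)%E.-integrable setT G.
Proof.
have /integrableP[_ iF] := continuous_integrable_rV cF FM.
apply/integrableP; split => //; move: iF.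
rewrite (_ : (\int[_]_x _ = \int[lebesgue_measure \x^ m2]_x `|G x|)%E)//.
rewrite (ge0_integral_pushforward (@measurable_consrV R n)
  (lebesgue_measure \x^ m2)%E)//.
exact: measurableT_comp.
Qed.

(** [cons_measure] pushes forward [\x^], while Fubini asks for integrability under [\x]. The two
    product measures agree because they agree on rectangles. *)
Let iG : (lebesgue_measure \x m2)%E.-integrable setT G.
Proof.
apply/integrableP; split => //.
have /integrableP[_] := iG2.
rewrite (_ : (\int[_]_x _ = \int[lebesgue_measure \x m2]_x `|G x|)%E)//.
apply: eq_measure_integral => A mA _; apply/esym.
apply: (@product_measure_unique _ _ _ _ _ _ m2 (lebesgue_measure \x^ m2)%E) mA.
by move=> B C mB mC; exact: product_measure2E.
Qed.

Let integral_consrV : (\int[lebesgue_rV n.+1]_x (F x)%:E =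
  \int[lebesgue_measure \x^ m2]_p G p)%E.
Proof.
exact: (integral_pushforward (@measurable_consrV R n) mF iG2 measurableT).
Qed.

Lemma integral_lebesgue_rVS12 : (\int[lebesgue_rV n.+1]_x (F x)%:E =
  \int[lebesgue_measure]_a \int[lebesgue_rV n]_v (F (consrV (a, v)))%:E)%E.
Proof. by rewrite integral_consrV -integral12_prod_meas2. Qed.

Lemma integral_lebesgue_rVS21 : (\int[lebesgue_rV n.+1]_x (F x)%:E =
  \int[lebesgue_rV n]_v \int[lebesgue_measure]_a (F (consrV (a, v)))%:E)%E.
Proof. by rewrite integral_consrV -integral21_prod_meas2. Qed.

End lebesgue_rVS.

(** * Derivatives along lines and vanishing integrals of derivatives *)

(** A directional derivative depends only on the restriction to a line, so it passes from a function
    on the space to its slices. *)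
Lemma is_derive_line (R : numFieldType) (V V' W : normedModType R)
    (f : V -> W) (g : V' -> W) x v y w l :
  (forall h : R, f (h *: v + x) = g (h *: w + y)) ->
  is_derive x v f l -> is_derive y w g l.
Proof.
move=> fg [df <-]; have gE : (fun h : R => h^-1 *: ((g \o shift y) (h *: w) - g y)) =
    (fun h => h^-1 *: ((f \o shift x) (h *: v) - f x)).
  apply/funext => h /=; rewrite fg; congr (_ *: (_ - _)).
  by have := fg 0; rewrite !scale0r !add0r.
by split; rewrite /derivable /derive gE.
Qed.

Lemma integral_derive_compact (R : realType) (M : R) (g D : R -> R) :
  continuous D -> (forall x : R, is_derive x (1 : R) g (D x)) ->
  [set x | g x != 0] `<=` `[- M, M] -> [set x | D x != 0] `<=` `[- M, M] ->
  (\int[lebesgue_measure]_x (D x)%:E = 0)%E.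
Proof.
(* [N] is positive and exceeds [M] whatever the sign of [M], so [g] vanishes at both ends of the
   interval where the fundamental theorem of calculus is applied. *)
move=> cD dg gM DM; pose N : R := `|M| + 1.
have out (h : R -> R) x : [set x | h x != 0] `<=` `[- M, M] -> N <= `|x| -> h x = 0.
  move=> hM Nx; apply: contra_leP Nx => /eqP hx.
  have /= := hM x hx; rewrite in_itv /= -ler_norml => /le_lt_trans; apply.
  by rewrite (le_lt_trans (ler_norm M))// /N ltrDl.
have N0 : 0 < N by rewrite ltr_wpDl.
have cg : continuous g.
  move=> x; apply: differentiable_continuous; apply/derivable1_diffP.
  by have [] := dg x.
transitivity (\int[lebesgue_measure]_(x in `[(- N)%R, N]) (D x)%:E)%E.
  rewrite [RHS]integral_mkcond; apply: eq_integral => x _.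
  rewrite patchE; case: ifPn => // /negP xN; congr EFin; apply: out => //.
  rewrite leNgt; apply/negP => /ltW; rewrite ler_norml => h; apply: xN.
  by rewrite inE /= in_itv.
rewrite (@continuous_FTC2 R D g)//.
- by rewrite !(out g) ?subee ?normrN// ger0_norm// ltW.
- by rewrite -subr_gt0 opprK addr_gt0.
- exact: continuous_subspaceT.
- split.
  + by move=> x _; have [] := dg x.
  + apply: cvg_at_right_filter; exact: cg.
  + apply: cvg_at_left_filter; exact: cg.
- by move=> x _; rewrite derive1E; have [] := dg x.
Qed.

Lemma cube_consrV (R : realType) n (M a : R) (v : 'rV[R]_n) :
  cube n.+1 M (consrV (a, v)) -> `[- M, M]%classic a /\ cube n M v.
Proof.
move=> h; split => [|i]; first by have := h ord0; rewrite consrV0.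
by have := h (lift ord0 i); rewrite consrVS.
Qed.

(** Induction on the dimension. For the first coordinate, integrate in it first and use the
    one-variable case; for any other, integrate the first coordinate last, and the inner integral
    vanishes by induction. *)
Lemma integral_partial_compact (R : realType) n (M : R) (i : 'I_n)
    (F D : 'rV[R]_n -> R) :
  continuous D -> (forall x, is_derive x (delta_mx ord0 i) F (D x)) ->
  [set x | F x != 0] `<=` cube n M -> [set x | D x != 0] `<=` cube n M ->
  (\int[lebesgue_rV n]_x (D x)%:E = 0)%E.
Proof.
elim: n i F D => [[]//|n IH] i F D cD dF FM DM.
have cDl (a : R) : continuous (fun v => D (consrV (a, v))).
  move=> v; apply: (@continuous_comp _ _ _ (fun v => consrV (a, v)) D).
    exact: continuous_consrVl.
  exact: cD.
have cDr (v : 'rV[R]_n) : continuous (fun a : R => D (consrV (a, v))).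
  move=> a; apply: (@continuous_comp _ _ _ (fun a : R => consrV (a, v)) D).
    exact: continuous_consrVr.
  exact: cD.
case: (unliftP ord0 i) => [j|] ij.
- rewrite (integral_lebesgue_rVS12 cD DM) integral0_eq// => a _.
  apply: (IH j (fun v => F (consrV (a, v)))) => //.
  + move=> v; apply: is_derive_line (dF (consrV (a, v))) => h; congr F.
    apply/rowP => k; rewrite ij [LHS]mxE; case: (unliftP ord0 k) => [k'|] ->.
      by rewrite !consrVS !mxE (inj_eq (@lift_inj _ _)).
    by rewrite !consrV0 !mxE (negPf (neq_lift _ _)) mulr0 add0r.
  + by move=> v /FM /cube_consrV[].
  + by move=> v /DM /cube_consrV[].
- rewrite (integral_lebesgue_rVS21 cD DM) integral0_eq// => v _.
  apply: (@integral_derive_compact R M (fun a => F (consrV (a, v)))) => //.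
  + move=> a; apply: is_derive_line (dF (consrV (a, v))) => h; congr F.
    apply/rowP => k; rewrite ij [LHS]mxE; case: (unliftP ord0 k) => [k'|] ->.
      by rewrite !consrVS !mxE [lift _ _ == _]eq_sym (negPf (neq_lift _ _)) mulr0 add0r.
    by rewrite !consrV0 !mxE !eqxx.
  + by move=> a /FM /cube_consrV[].
  + by move=> a /DM /cube_consrV[].
Qed.

(** * The Euclidean norm and the distance to a sphere *)

Section euclidean_norm.
Context {R : realType} {n : nat}.
Implicit Types x y c : 'rV[R]_n.

Lemma enorm_ge0 x : 0 <= enorm x.
Proof. exact: sqrtr_ge0. Qed.

Lemma sqr_enorm x : enorm x ^+ 2 = \sum_i x ord0 i ^+ 2.
Proof. by rewrite sqr_sqrtr// sumr_ge0// => i _; exact: sqr_ge0. Qed.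

Lemma enormN x : enorm (- x) = enorm x.
Proof. by congr Num.sqrt; apply: eq_bigr => i _; rewrite mxE sqrrN. Qed.

Lemma enormZ (a : R) x : enorm (a *: x) = `|a| * enorm x.
Proof.
apply/eqP; rewrite -(@eqrXn2 _ 2)// ?mulr_ge0 ?enorm_ge0//; apply/eqP.
rewrite exprMn !sqr_enorm real_normK ?num_real// mulr_sumr.
by apply: eq_bigr => i _; rewrite mxE exprMn.
Qed.

Lemma enorm_delta (i : 'I_n) : enorm (delta_mx ord0 i : 'rV[R]_n) = 1.
Proof.
rewrite /enorm (bigD1 i)//= mxE !eqxx expr1n big1 ?addr0 ?sqrtr1// => j ji.
by rewrite mxE (negPf ji) expr0n.
Qed.

Lemma coord_le_enorm x i : `|x ord0 i| <= enorm x.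
Proof.
rewrite -(@ler_pXn2r _ 2)// ?nnegrE ?enorm_ge0//.
rewrite sqr_enorm real_normK ?num_real// (bigD1 i)//= lerDl.
by apply: sumr_ge0 => j _; exact: sqr_ge0.
Qed.

(** Cauchy-Schwarz: with P the inner product, the sum of the squares of |x|^2 y_i - P x_i equals
    |x|^2 (|x|^2 |y|^2 - P^2). *)
Lemma sum_mul_le_enorm x y : \sum_i x ord0 i * y ord0 i <= enorm x * enorm y.
Proof.
(* The existential keeps [P] opaque, an atom for [ring] and [lra]. *)
have [P PE] : exists P, P = \sum_i x ord0 i * y ord0 i by eexists.
rewrite -PE; suff : P ^+ 2 <= (enorm x * enorm y) ^+ 2.
  have [P0|P0 PP] := leP P 0; first by rewrite (le_trans P0)// mulr_ge0 ?enorm_ge0.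
  by rewrite -(@ler_pXn2r _ 2)// nnegrE ?mulr_ge0 ?enorm_ge0// ltW.
rewrite exprMn; have [x0|x0] := eqVneq (enorm x) 0.
  suff -> : P = 0 by rewrite expr0n mulr_ge0 ?sqr_ge0.
  rewrite PE; apply: big1 => i _; have := coord_le_enorm x i.
  by rewrite x0 normr_le0 => /eqP ->; rewrite mul0r.
have A0 : 0 < enorm x ^+ 2 by rewrite exprn_gt0// lt_def x0 enorm_ge0.
rewrite -(ler_pM2l A0).
have : 0 <= \sum_i (enorm x ^+ 2 * y ord0 i - P * x ord0 i) ^+ 2.
  by apply: sumr_ge0 => i _; exact: sqr_ge0.
have -> : \sum_i (enorm x ^+ 2 * y ord0 i - P * x ord0 i) ^+ 2 =
    enorm x ^+ 2 ^+ 2 * (\sum_i y ord0 i ^+ 2)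
    - enorm x ^+ 2 * P *+ 2 * P + P ^+ 2 * (\sum_i x ord0 i ^+ 2).
  rewrite [in X in _ - _ * X]PE !mulr_sumr -sumrN -!big_split/=.
  by apply: eq_bigr => i _; ring.
by rewrite -!sqr_enorm; set A := enorm x ^+ 2; set B := enorm y ^+ 2; lra.
Qed.

Lemma ler_enormD x y : enorm (x + y) <= enorm x + enorm y.
Proof.
rewrite -(@ler_pXn2r _ 2)// ?nnegrE ?addr_ge0 ?enorm_ge0//.
rewrite sqrrD !sqr_enorm.
have -> : \sum_i (x + y) ord0 i ^+ 2 = \sum_i x ord0 i ^+ 2
    + (\sum_i x ord0 i * y ord0 i) *+ 2 + \sum_i y ord0 i ^+ 2.
  rewrite -sumrMnl -!big_split/=; apply: eq_bigr => i _.
  by rewrite mxE sqrrD.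
by rewrite lerD2r lerD2l lerMn2r sum_mul_le_enorm.
Qed.

Lemma continuous_coordB c i : continuous (fun x => (x - c) ord0 i).
Proof.
have -> : (fun x : 'rV[R]_n => (x - c) ord0 i) = (fun x => x ord0 i - c ord0 i).
  by apply/funext => x; rewrite !mxE.
move=> x; exact: (continuousB (@coord_continuous _ _ _ ord0 i x)
  (@cst_continuous _ _ (c ord0 i) x)).
Qed.

Lemma continuous_sqr_enorm c : continuous (fun x => enorm (x - c) ^+ 2).
Proof.
under eq_fun do rewrite sqr_enorm.
have ci i : continuous (fun x => (x - c) ord0 i ^+ 2).
  by move=> x; exact: (continuousM (@continuous_coordB c i x) (@continuous_coordB c i x)).
move=> x; apply: cvg_big => [||i _]; last exact: ci.
- exact: add_continuous.
- exact: (@nbhs_filter 'rV[R]_n).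
Qed.

Lemma continuous_enorm c : continuous (fun x => enorm (x - c)).
Proof.
have -> : (fun x => enorm (x - c)) = Num.sqrt \o (fun x => enorm (x - c) ^+ 2).
  by apply/funext => x /=; rewrite sqrtr_sqr ger0_norm// enorm_ge0.
move=> x; apply: continuous_comp; first exact: continuous_sqr_enorm.
exact: sqrt_continuous.
Qed.

Lemma open_eball c (r : R) : open (eball c r).
Proof.
have /continuousP/(_ _ (@open_lt R r)) := @continuous_enorm c.
exact.
Qed.

Lemma eball_cube c (r : R) : eball c r `<=` cube n (r + enorm c).
Proof.
move=> x /= xr i; rewrite /= in_itv /= -ler_norml.
rewrite (le_trans (coord_le_enorm x i))// -[x in enorm x](subrK c).
by rewrite (le_trans (ler_enormD _ _))// lerD2r ltW.
Qed.

(** A point of the sphere is approached from inside along its radius. *)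
Lemma boundary_eball c (r : R) x :
  0 < r -> enorm (x - c) = r -> boundary (eball c r) x.
Proof.
move=> r0 xr; split; last first.
  by move=> /interior_subset; rewrite /eball/= xr ltxx.
move=> U xU.
have cphi : {for (1 : R), continuous (fun t : R => t *: (x - c) + c)}.
  by apply: cvgD; [apply: cvgZr_tmp; exact: cvg_id|exact: cvg_cst].
have : nbhs (1 *: (x - c) + c) U by rewrite scale1r subrK.
move=> /cphi /nbhs_ballP[e /= e0 eU].
(* This [t] lies in [1/2, 1) and within [e] of 1. *)
pose t : R := 1 - Num.min e 1 / 2.
have m0 : 0 < Num.min e 1 by rewrite lt_min e0 ltr01.
have m1 : Num.min e 1 <= 1 by rewrite ge_min lexx orbT.
have me : Num.min e 1 <= e by rewrite ge_min lexx.
exists (t *: (x - c) + c); split.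
  rewrite /eball/= addrK enormZ xr gtr_pMl// ger0_norm /t; lra.
apply: eU; rewrite /ball /= /t opprB addrCA subrr addr0 ger0_norm; lra.
Qed.

(** The triangle inequality gives the lower bound, the radial projection of [x] the upper one. In
    dimension 0 the boundary would be empty and its [inf] the default 0. *)
Lemma bdry_dist_eball c (r : R) x : (0 < n)%N ->
  0 < r -> eball c r x -> bdry_dist (eball c r) x = r - enorm (x - c).
Proof.
move=> n0 r0 xr.
have lb y : boundary (eball c r) y -> r - enorm (x - c) <= enorm (x - y).
  move=> [_ yI]; rewrite lerBlDr leNgt; apply/negP => yr; apply: yI.
  apply: (@open_nbhs_nbhs _ y (eball c r)); split; first exact: open_eball.
  rewrite /eball/=; apply: le_lt_trans yr; rewrite -(subrKA x) -(enormN (x - y)) opprB.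
  exact: ler_enormD.
(* [c + w] is the radial projection of [x]; at the centre any direction serves, and the first basis
   vector is taken. *)
have [w wr xw] : exists2 w, enorm w = r & enorm (x - c - w) <= r - enorm (x - c).
  have [x0|x0] := eqVneq (enorm (x - c)) 0.
    exists (r *: delta_mx ord0 (Ordinal n0)).
      by rewrite enormZ enorm_delta mulr1 gtr0_norm.
    rewrite (le_trans (ler_enormD _ _))// enormN x0 add0r subr0.
    by rewrite enormZ enorm_delta mulr1 gtr0_norm.
  have e0 : 0 < enorm (x - c) by rewrite lt_def x0 enorm_ge0.
  exists ((r / enorm (x - c)) *: (x - c)).
    by rewrite enormZ ger0_norm ?divr_ge0 ?(ltW r0) ?(ltW e0)// divfK.
  rewrite -[in X in X - _](scale1r (x - c)) -scalerBl enormZ ler0_norm; last first.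
    by rewrite subr_le0 ler_pdivlMr// mul1r ltW.
  by rewrite opprB mulrBl mul1r divfK.
have bw : boundary (eball c r) (c + w).
  by apply: boundary_eball => //; rewrite addrC addKr.
rewrite /bdry_dist; apply/le_anti/andP; split.
  apply: le_trans xw; rewrite -addrA -opprD; apply: ge_inf; last by exists (c + w).
  by exists (r - enorm (x - c)) => _ [y yb <-]; exact: lb.
apply: lb_le_inf; first by exists (enorm (x - (c + w))), (c + w).
by move=> _ [y yb <-]; exact: lb.
Qed.

End euclidean_norm.

(** * The one-variable inequality *)

(* With t = rho / r, the difference of the two sides is
   ((1 + t) * p + 1 / 2) / ((1 - t) * (1 + t) ^+ 2) at N = 2, for the polynomial
   p in t ^+ 2 below, and p + 1 / 4 is a sum of squares. *)
Lemma hardy_weight_unit (R : realFieldType) (N t q G : R) : 2 <= N -> 0 <= t < 1 ->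
  q = 1 - t ^+ 2 -> G = q^-1 + 2 / 5 + 16 / 25 * q ->
  4^-1 * (1 - t) ^- 2 + 2 * (N - 1) <=
  N * G + 2 * t ^+ 2 * (q ^- 2 - 16 / 25) - t ^+ 2 * G ^+ 2.
Proof.
move=> N2 /andP[t0 t1] qE' GE.
have q0 : 0 < q by rewrite qE'; nra.
have qE : q = (1 - t) * (1 + t) by rewrite qE'; ring.
have d0 : 0 < 1 - t by lra.
have e0 : 0 < 1 + t by lra.
(* The coefficients 2/5 and 16/25 make q (G - 2) a perfect square. Raising N by one adds G on the
   right and 2 on the left, so [2 <= G] reduces the claim to N = 2. *)
have G2 : 2 <= G.
  rewrite -subr_ge0.
  have -> : G - 2 = q^-1 * (1 - 4 / 5 * q) ^+ 2 by rewrite GE; field; rewrite gt_eqF.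
  by rewrite mulr_ge0 ?invr_ge0 ?sqr_ge0 ?ltW.
pose p := 133 / 100 + t ^+ 2 * (- (3626 / 625) + t ^+ 2 * (3908 / 625
  + t ^+ 2 * (- (1088 / 625) + t ^+ 2 * (256 / 625)))).
have p0 : - (1 / 4) <= p.
  rewrite -subr_ge0 opprK.
  have -> : p + 1 / 4 = (16 / 25 * t ^+ 4 - 34 / 25 * t ^+ 2 + 16 / 25) ^+ 2
      + 448 / 125 * (t ^+ 2 - 1269 / 2240) ^+ 2 + 163 / 1000 * (173 / 1400).
    by rewrite /p; field.
  apply: addr_ge0; last by lra.
  apply: addr_ge0; first exact: sqr_ge0.
  by apply: mulr_ge0; [lra|exact: sqr_ge0].
have NG : (N - 2) * 2 <= (N - 2) * G by rewrite ler_wpM2l// subr_ge0.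
have h : 0 <= 2 * G + 2 * t ^+ 2 * (q ^- 2 - 16 / 25) - t ^+ 2 * G ^+ 2
    - (4^-1 * (1 - t) ^- 2 + 2).
  have -> : 2 * G + 2 * t ^+ 2 * (q ^- 2 - 16 / 25) - t ^+ 2 * G ^+ 2
      - (4^-1 * (1 - t) ^- 2 + 2) =
      ((1 + t) * p + 1 / 2) / ((1 - t) * (1 + t) ^+ 2).
    by rewrite GE qE /p; field; rewrite !gt_eqF.
  apply: divr_ge0; last by rewrite mulr_ge0 ?sqr_ge0 ?(ltW d0).
  (* As p >= -1/4 and 1 + t <= 2, the product (1 + t) p is at least -1/2. *)
  by clear -t0 t1 p0; nra.
rewrite -subr_ge0; apply: (le_trans (addr_ge0 h (_ : 0 <= (N - 2) * G - (N - 2) * 2))).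
  by rewrite subr_ge0.
by rewrite le_eqVlt; apply/orP; left; apply/eqP; ring.
Qed.

(** The right side is div V - |V|^2 in dimension N: the gradient of q is -2 (x - c), so the radial
    part of div V is 2 rho^2 (q^-2 - (16/25)/r^4). *)
Lemma hardy_weight (R : realFieldType) (N r rho q G : R) :
  2 <= N -> 0 < r -> 0 <= rho < r -> q = r ^+ 2 - rho ^+ 2 ->
  G = q^-1 + 2 / 5 / r ^+ 2 + 16 / 25 / r ^+ 4 * q ->
  4^-1 * (r - rho) ^- 2 + 2 * (N - 1) / r ^+ 2 <=
  N * G + 2 * rho ^+ 2 * (q ^- 2 - 16 / 25 / r ^+ 4) - rho ^+ 2 * G ^+ 2.
Proof.
move=> N2 r0 /andP[rho0 rhor] qE GE.
have [t rhoE] : exists t, rho = r * t by exists (rho / r); rewrite mulrC divfK ?gt_eqF.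
have t01 : 0 <= t < 1.
  move: rho0 rhor; rewrite rhoE pmulr_rge0// => ->.
  by rewrite gtr_pMr.
have /= := hardy_weight_unit N2 t01 erefl erefl.
have t1 : 1 - t != 0 by case/andP: t01 => _ t1; rewrite subr_eq0 gt_eqF.
have t2 : 1 - t ^+ 2 != 0.
  by case/andP: t01 => t0 t1'; rewrite gt_eqF//; nra.
have rn : r != 0 by rewrite gt_eqF.
(* Under rho = r t both sides are r^-2 times those for the unit ball. *)
rewrite -(ler_pM2l (x := (r ^+ 2)^-1)) ?invr_gt0 ?exprn_gt0//.
congr (_ <= _).
  rewrite rhoE; field; rewrite rn t1 /=.
  by rewrite -{1}(mulr1 r) -mulrBr mulf_neq0.
rewrite GE qE rhoE.
have -> : r ^+ 2 - (r * t) ^+ 2 = r ^+ 2 * (1 - t ^+ 2) by ring.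
by field; rewrite rn t2.
Qed.

(** * Quotients whose numerator is supported where the denominator is nonzero *)

Section quotient_supported.
Context {R : realType} {V : normedModType R}.
Variables (K : set V) (u d : V -> R).
Hypotheses (cK : closed K) (uK : [set x | u x != 0] `<=` K)
  (dK : forall x, K x -> d x != 0).

Lemma near_supported (x : V) : ~ K x -> \forall y \near x, u y = 0.
Proof.
move=> Kx; have : nbhs x (~` K) by apply: open_nbhs_nbhs; split=> //; exact: closed_openC.
by apply: filterS => y Ky; apply/eqP; apply: contra_notT Ky => /uK.
Qed.

Let near_quot x : ~ K x -> \forall y \near x, u y / d y = 0.
Proof. by move/near_supported; apply: filterS => y ->; rewrite mul0r. Qed.

(** Off the closed set K the numerator vanishes on a neighbourhood, so zeros of [d] there do no
    harm. This makes f/q regular on the whole space although q vanishes on the sphere. *)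
Lemma continuous_quot_supported : continuous u -> continuous d ->
  continuous (fun x => u x / d x).
Proof.
move=> cu cd x; have [Kx|Kx] := pselect (K x); last first.
  exact: near_cst_continuous (near_quot Kx).
exact: (continuousM (cu x) (continuousV (dK Kx) (cd x))).
Qed.

Lemma is_derive_supported (x v : V) l : ~ K x -> is_derive x v u l -> l = 0.
Proof.
move=> Kx [_ <-]; rewrite (near_eq_derive (g := cst 0)) ?derive_cst//.
exact: near_supported.
Qed.

(** The derivative is written as a single quotient by [d], so that its continuity follows from
    [continuous_quot_supported] again. *)
Lemma is_derive_quot_supported (x v : V) l m :
  is_derive x v u l -> is_derive x v d m ->
  is_derive x v (fun y => u y / d y) ((l - u x / d x * m) / d x).
Proof.
move=> du dd; have [Kx|Kx] := pselect (K x); last first.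
  rewrite (is_derive_supported Kx du) (nbhs_singleton (near_supported Kx)).
  rewrite !mul0r subrr mul0r; apply: (near_eq_is_derive (f := cst 0)).
  by apply: filterS (near_quot Kx) => y ->.
have dx := dK Kx.
have dV : is_derive x v (fun y => (d y)^-1) (- (d x) ^- 2 *: m).
  by case: dd => dd <-; split; [exact: derivableV|exact: deriveV].
have -> : (fun y => u y / d y) = u * (fun y => (d y)^-1) by [].
apply: (is_derive_eq (is_deriveM du dV)).
by rewrite /GRing.scale /=; field.
Qed.

End quotient_supported.

(** * Derivatives of the squared distance; continuity of sums and products *)

Section derive_enorm.
Context {R : realType} {n : nat}.
Implicit Types x c : 'rV[R]_n.

Lemma is_derive_coordB c x (i j : 'I_n) :
  is_derive x (delta_mx ord0 i) (fun y => (y - c) ord0 j) ((j == i)%:R : R).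
Proof.
have : is_derive (0 : R) (1 : R) (fun t => t * (j == i)%:R + (x - c) ord0 j)
    ((j == i)%:R : R).
  apply: is_derive_eq; rewrite /GRing.scale /=; ring.
apply: is_derive_line => t; rewrite !mxE /GRing.scale /=; ring.
Qed.

Lemma is_derive_sqr_enorm c x (i : 'I_n) :
  is_derive x (delta_mx ord0 i) (fun y => enorm (y - c) ^+ 2)
    (2 * (x - c) ord0 i).
Proof.
have -> : (fun y => enorm (y - c) ^+ 2) =
    \sum_j (fun y : 'rV[R]_n => (y - c) ord0 j) ^+ 2.
  by apply/funext => y; rewrite sqr_enorm fct_sumE.
have dj j := is_deriveX 2 (is_derive_coordB c x i j).
apply: is_derive_eq (is_derive_sum dj) _.
rewrite (bigD1 i)//= eqxx big1 ?addr0 => [|j /negPf ->]; rewrite /GRing.scale /=; ring.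
Qed.

End derive_enorm.

Lemma continuousDf (R : numFieldType) (T : topologicalType) (u v : T -> R) :
  continuous u -> continuous v -> continuous (fun x => u x + v x).
Proof. by move=> cu cv x; exact: (continuousD (cu x) (cv x)). Qed.

Lemma continuousMf (R : numFieldType) (T : topologicalType) (u v : T -> R) :
  continuous u -> continuous v -> continuous (fun x => u x * v x).
Proof. by move=> cu cv x; exact: (continuousM (cu x) (cv x)). Qed.

Lemma continuous_sumf (R : numFieldType) (T : topologicalType) n
    (u : 'I_n -> T -> R) :
  (forall i, continuous (u i)) -> continuous (fun x => \sum_i u i x).
Proof.
move=> cu; have -> : (fun x => \sum_i u i x) = \sum_i u i.
  by apply/funext => x; rewrite fct_sumE.
apply: (big_ind (fun w : T -> R => continuous w)) => //.
- exact: cst_continuous.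
- exact: continuousDf.
Qed.

(** * The field f^2 V and the integrated inequality *)

Section hardy_field.
Context {R : realType} {n : nat}.
Variables (c : 'rV[R]_n) (r : R) (f : 'rV[R]_n -> R).
Hypotheses (n2 : (2 <= n)%N) (r0 : 0 < r) (hf : test_function (eball c r) f).

Let K := fsupport f.
Let y i x := (x - c) ord0 i.
Let q x := r ^+ 2 - enorm (x - c) ^+ 2.
Let p i := partial i f.
Let h x := f x / q x.
Let al := 2 / 5 / r ^+ 2.
Let be := 16 / 25 / r ^+ 4.
(** This is f G, expanded so that the singular factor 1/q occurs only in the quotient [h]. *)
Let g x := h x + al * f x + be * (q x * f x).
Let dh i x := (p i x - h x * - (2 * y i x)) / q x.
Let dg i x := dh i x + al * p i x + be * (q x * p i x + f x * - (2 * y i x)).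
(** The [i]-th component of f^2 V; [D i] below is its [i]-th partial derivative. *)
Let F i x := f x * g x * y i x.
Let D i x := f x * g x + y i x * (f x * dg i x + g x * p i x).

Let cK : closed K. Proof. exact: closed_closure. Qed.

Let Kball : K `<=` eball c r. Proof. by case: hf. Qed.

Let fK : [set x | f x != 0] `<=` K. Proof. exact: subset_closure. Qed.

Let cf : continuous f. Proof. by case: hf => /(_ [::])[]. Qed.

Let cp i : continuous (p i). Proof. by case: hf => /(_ [:: i])[]. Qed.

Let dp i x : is_derive x (delta_mx ord0 i) f (p i x).
Proof. by case: hf => /(_ [::])[_ df] _ _; split; first exact: df. Qed.

Let pK i : [set x | p i x != 0] `<=` K.
Proof.
by move=> x; apply: contra_neqP => Kx; exact: (is_derive_supported cK fK Kx (dp i x)).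
Qed.

Let f0 x : ~ K x -> f x = 0.
Proof. by move=> Kx; apply/eqP; apply: contra_notT Kx; exact: fK. Qed.

Let p0 i x : ~ K x -> p i x = 0.
Proof. by move=> Kx; apply/eqP; apply: contra_notT Kx; exact: pK. Qed.

Let qK x : K x -> q x != 0.
Proof.
move=> /Kball xr; rewrite /q subr_eq0 gt_eqF// ltr_pXn2r ?nnegrE ?enorm_ge0//.
exact: ltW.
Qed.

Let cq : continuous q.
Proof.
move=> x; exact: (continuousB (@cst_continuous _ _ (r ^+ 2) x)
  (@continuous_sqr_enorm _ _ c x)).
Qed.

Let cy i : continuous (y i). Proof. exact: continuous_coordB. Qed.

Let ch : continuous h. Proof. exact: (continuous_quot_supported cK fK qK cf cq). Qed.

Let dq i x : is_derive x (delta_mx ord0 i) q (- (2 * y i x)).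
Proof.
apply: (is_derive_eq (is_deriveB (is_derive_cst (r ^+ 2) x (delta_mx ord0 i))
  (is_derive_sqr_enorm c x i))).
by rewrite sub0r.
Qed.

Let dhE i x : is_derive x (delta_mx ord0 i) h (dh i x).
Proof. exact: (is_derive_quot_supported cK fK qK (dp i x) (dq i x)). Qed.

Let cst_cont (a : R) : continuous (fun _ : 'rV[R]_n => a).
Proof. exact: cst_continuous. Qed.

Let cdh i : continuous (dh i).
Proof.
apply: (continuous_quot_supported cK _ qK _ cq).
  move=> x /=; apply: contra_neqP => Kx; rewrite /h.
  by rewrite p0// f0// !mul0r subrr.
apply: continuousDf => //.
have -> : (fun x => - (h x * - (2 * y i x))) = (fun x => h x * (2 * y i x)).
  by apply/funext => x; rewrite mulrN opprK.
by do 2 apply: continuousMf => //.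
Qed.

Let cg : continuous g.
Proof.
exact: (continuousDf (continuousDf ch (continuousMf (@cst_cont al) cf))
  (continuousMf (@cst_cont be) (continuousMf cq cf))).
Qed.

Let cD i : continuous (D i).
Proof.
have c2y : continuous (fun x => - (2 * y i x)).
  by under eq_fun do rewrite -mulNr; exact: continuousMf.
have cdg : continuous (dg i).
  exact: (continuousDf (continuousDf (@cdh i) (continuousMf (@cst_cont al) (@cp i)))
    (continuousMf (@cst_cont be)
      (continuousDf (continuousMf cq (@cp i)) (continuousMf cf c2y)))).
exact: (continuousDf (continuousMf cf cg) (continuousMf (@cy i)
  (continuousDf (continuousMf cf cdg) (continuousMf cg (@cp i))))).
Qed.

Let dF i x : is_derive x (delta_mx ord0 i) (F i) (D i x).
Proof.
have e1 := is_deriveM (is_derive_cst al x (delta_mx ord0 i)) (dp i x).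
have e2 := is_deriveM (is_derive_cst be x (delta_mx ord0 i))
  (is_deriveM (dq i x) (dp i x)).
have e3 := is_deriveM (dp i x) (is_deriveD (is_deriveD (dhE i x) e1) e2).
have e4 := is_deriveM e3 (is_derive_coordB c x i i).
apply: (is_derive_eq e4).
rewrite eqxx /GRing.scale /=.
(* The variables stand for f, g, y, dh, p, the derivative of q, and q, in that order. *)
suff e (a b w u v z k : R) :
    a * b * 1 + w * (a * (u + (al * v + a * 0)
      + (be * (k * v + a * z) + k * a * 0)) + b * v) =
    a * b + w * (a * (u + al * v + be * (k * v + a * z)) + b * v) by exact: e.
by ring.
Qed.

Let k x := f x / (r - enorm (x - c)).

(** The right side equals |grad f + f V|^2 + f^2 (div V - |V|^2), and [hardy_weight] bounds the last
    factor on the support. Elsewhere both sides are zero. *)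
Let hardy_pointwise x : 4^-1 * k x ^+ 2 + 2 * (n%:R - 1) / r ^+ 2 * f x ^+ 2 <=
  \sum_i p i x ^+ 2 + \sum_i D i x.
Proof.
have [Kx|Kx] := pselect (K x); last first.
  rewrite /k f0// !mul0r expr0n /= !mulr0 addr0.
  rewrite !big1 ?addr0 ?mulr0// => i _; last by rewrite p0// expr0n.
  by rewrite /D f0// p0// !mul0r !mulr0 !addr0 mulr0 addr0.
have xr := Kball Kx; have qx := qK Kx.
have rn : r != 0 by rewrite gt_eqF.
pose rho := enorm (x - c).
have rr : r - rho != 0 by rewrite subr_eq0 gt_eqF.
pose G := (q x)^-1 + al + be * q x.
have rho_r : 0 <= rho < r by rewrite enorm_ge0.
have n2R : 2 <= n%:R :> R by rewrite ler_nat.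
have := hardy_weight n2R r0 rho_r (erefl (q x)) (erefl G).
rewrite -/be => /(ler_wpM2l (sqr_ge0 (f x))) W.
have -> : 4^-1 * k x ^+ 2 + 2 * (n%:R - 1) / r ^+ 2 * f x ^+ 2 =
    f x ^+ 2 * (4^-1 * (r - rho) ^- 2 + 2 * (n%:R - 1) / r ^+ 2).
  by rewrite /k -/rho; field; rewrite rr rn.
apply: (le_trans W); rewrite -big_split /=.
rewrite -subr_ge0.
have -> : \sum_i (p i x ^+ 2 + D i x) - f x ^+ 2 * (n%:R * G
    + 2 * rho ^+ 2 * ((q x) ^- 2 - be) - rho ^+ 2 * G ^+ 2) =
    \sum_i (p i x + f x * G * y i x) ^+ 2; last first.
  by apply: sumr_ge0 => i _; exact: sqr_ge0.
(* Spreading n G and rho^2 over the coordinates lets the square be completed term by term. *)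
have -> : n%:R * G + 2 * rho ^+ 2 * ((q x) ^- 2 - be) - rho ^+ 2 * G ^+ 2 =
    \sum_i (G + y i x ^+ 2 * (2 * ((q x) ^- 2 - be) - G ^+ 2)).
  rewrite big_split /= -mulr_suml -[\sum_i y i x ^+ 2]sqr_enorm -/rho.
  by rewrite sumr_const card_ord mulr_natl; ring.
rewrite mulr_sumr -sumrB; apply: eq_bigr => i _.
by rewrite /D /g /dg /dh /h /G; field.
Qed.

Let Kcube : K `<=` cube n (r + enorm c).
Proof. by move=> x /Kball /eball_cube. Qed.

Let integrableK (u : 'rV[R]_n -> R) : continuous u -> [set x | u x != 0] `<=` K ->
  (lebesgue_rV n).-integrable setT (EFin \o u).
Proof.
move=> cu uK; apply: (continuous_integrable_rV (M := r + enorm c) cu).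
by move=> x /uK /Kcube.
Qed.

Let FK i : [set x | F i x != 0] `<=` K.
Proof.
by move=> x; apply: contra_neqP => Kx; rewrite /F f0// !mul0r.
Qed.

Let DK i : [set x | D i x != 0] `<=` K.
Proof.
move=> x; apply: contra_neqP => Kx.
exact: (is_derive_supported cK (@FK i) Kx (dF i x)).
Qed.

Let integrable_sum_D :
  (lebesgue_rV n).-integrable setT (EFin \o (fun x => \sum_i D i x)).
Proof.
apply: integrableK; first exact: continuous_sumf.
move=> x; apply: contra_neqP => Kx; apply: big1 => i _.
by apply/eqP; apply: contra_notT Kx; exact: DK.
Qed.

(** The divergence theorem for f^2 V, one coordinate at a time. *)
Let integral_sum_D : (\int[lebesgue_rV n]_x (\sum_i D i x)%:E = 0)%E.
Proof.
under eq_integral do rewrite -sumEFin.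
rewrite integral_sum//; last by move=> i; apply: integrableK; [exact: cD|exact: DK].
apply: big1 => i _; apply: (integral_partial_compact (M := r + enorm c) (@cD i) (dF i)).
- by move=> x /FK /Kcube.
- by move=> x /DK /Kcube.
Qed.

(** Here [n] is the full dimension, whence n - 1 in the constant. *)
Lemma hardy_integral :
  ((4^-1)%:E * \int[lebesgue_rV n]_x ((f x / (r - enorm (x - c))) ^+ 2)%:E +
   (2 * (n%:R - 1) / r ^+ 2)%:E * \int[lebesgue_rV n]_x (f x ^+ 2)%:E <=
   \int[lebesgue_rV n]_x (\sum_i partial i f x ^+ 2)%:E)%E.
Proof.
have iP : (lebesgue_rV n).-integrable setT (EFin \o (fun x => \sum_i p i x ^+ 2)).
  apply: integrableK.
    by apply: continuous_sumf => i; exact: (continuousMf (@cp i) (@cp i)).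
  move=> x; apply: contra_neqP => Kx; apply: big1 => i _.
  by rewrite p0// expr0n.
have if2 : (lebesgue_rV n).-integrable setT (EFin \o (fun x => f x ^+ 2)).
  apply: integrableK; first exact: (continuousMf cf cf).
  by move=> x /=; rewrite sqrf_eq0; exact: fK.
(* On the support of [f], inside the open ball, r - |x - c| does not vanish, so [k] is continuous
   with compact support. *)
have ik2 : (lebesgue_rV n).-integrable setT (EFin \o (fun x => k x ^+ 2)).
  have ck : continuous k.
    apply: (continuous_quot_supported cK fK _ cf) => [x /Kball xr|x].
      by rewrite subr_eq0 gt_eqF.
    exact: (continuousB (@cst_continuous _ _ r x) (@continuous_enorm _ _ c x)).
  apply: integrableK; first exact: (continuousMf ck ck).
  by move=> x /=; rewrite sqrf_eq0 mulf_eq0 negb_or => /andP[/fK].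
(* Adding the divergence leaves the integral unchanged and reduces the claim to the pointwise
   bound. *)
have <- : (\int[lebesgue_rV n]_x (\sum_i p i x ^+ 2 + \sum_i D i x)%:E =
    \int[lebesgue_rV n]_x (\sum_i partial i f x ^+ 2)%:E)%E.
  by rewrite (integralD_EFin measurableT iP integrable_sum_D) integral_sum_D adde0.
rewrite -(integralZl measurableT ik2) -(integralZl measurableT if2).
rewrite -(integralD measurableT (integrableZl measurableT _ ik2)
  (integrableZl measurableT _ if2)).
apply: le_integral => //.
- exact: (integrableD measurableT (integrableZl measurableT _ ik2)
    (integrableZl measurableT _ if2)).
- exact: (integrableD measurableT iP integrable_sum_D).
- by move=> x _; rewrite -!EFinM -EFinD lee_fin; exact: hardy_pointwise.
Qed.

End hardy_field.

(** * Passage from the whole space to the ball *)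

Lemma integral_supported d (T : measurableType d) (R : realType)
    (mu : {measure set T -> \bar R}) (B : set T) (u : T -> R) :
  [set x | u x != 0] `<=` B ->
  (\int[mu]_(x in B) (u x)%:E = \int[mu]_x (u x)%:E)%E.
Proof.
move=> uB; rewrite integral_mkcond; apply: eq_integral => x _.
rewrite patchE; case: ifPn => // xB; congr EFin; apply/esym/eqP.
by apply: contraNT xB => /uB /mem_set.
Qed.

Theorem corollary1p4 (R : realType) (n : nat) (c : 'rV[R]_n.+1) (r : R)
    (hn : (1 <= n)%N) (hr : 0 < r)
    (f : 'rV[R]_n.+1 -> R) (hf : test_function (eball c r) f) :
  (\int[lebesgue_rV n.+1]_(x in eball c r) (enorm (grad f x) ^+ 2)%:E >=
   (4^-1)%:E * (\int[lebesgue_rV n.+1]_(x in eball c r)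
                  (`|f x| ^+ 2 / bdry_dist (eball c r) x ^+ 2)%:E) +
   (2 * n%:R / r ^+ 2)%:E * (\int[lebesgue_rV n.+1]_(x in eball c r)
                  (`|f x| ^+ 2)%:E))%E.
Proof.
have [_ _ sB] := hf.
have fB x : f x != 0 -> eball c r x by move=> fx; exact/sB/subset_closure.
have gradE x : enorm (grad f x) ^+ 2 = \sum_i partial i f x ^+ 2.
  by rewrite sqr_enorm; apply: eq_bigr => i _; rewrite mxE.
under [X in (_ <= X)%E]eq_integral do rewrite gradE.
under [X in (_ * X + _)%E]eq_integral => x xB.
  rewrite (bdry_dist_eball _ hr (set_mem xB))// real_normK ?num_real// -expr_div_n.
  over.
under [X in (_ + _ * X)%E]eq_integral do rewrite real_normK ?num_real//.
have pB i x : ~ eball c r x -> partial i f x = 0.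
  move=> xB; apply: (is_derive_supported (@closed_closure _ [set x | f x != 0])
    (@subset_closure _ _) _ (_ : is_derive x (delta_mx ord0 i) f _)).
    by move/sB.
  by case: hf => /(_ [::])[_ df] _ _; split; first exact: df.
(* All three integrands vanish outside the ball, so each integral extends to the whole space. *)
rewrite (@integral_supported _ _ _ _ _ (fun x => (f x / (r - enorm (x - c))) ^+ 2)).
  rewrite (@integral_supported _ _ _ _ _ (fun x => f x ^+ 2)).
    rewrite (@integral_supported _ _ _ _ _ (fun x => \sum_i partial i f x ^+ 2)).
      have := @hardy_integral R n.+1 c r f hn hr hf.
      (* The dimension is n + 1, so the constant 2 ((n + 1) - 1) is 2n. *)
      by rewrite -[n.+1%:R]natr1 addrK.
    move=> x; apply: contra_neqP => xB; apply: big1 => i _.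
    by rewrite pB// expr0n.
  by move=> x /=; rewrite sqrf_eq0 => /fB.
by move=> x /=; rewrite sqrf_eq0 mulf_eq0 negb_or => /andP[/fB].
Qed.
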